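(* Let $n$ be a positive integer, $q:=2^n$, and let $\mathbf R=(R,+,\cdot)$ be a (not necessarily unitary) commutative ring of characteristic $2$ (i.e. $x+x=0$ for all $x\in R$) satisfying $x^{2^n}=x$ for all $x\in R$. Define a binary operation $\wedge$ on $R$ by \[ x\wedge y:=\sum_{i=1}^{q-1}x^iy^{q-i}\qquad (x,y\in R). \] Then $(R,\wedge)$ is a meet-semilattice with smallest element $0$ whose induced order $\le$ is given by: for $x,y\in R$, $x\le y$ if and only if $xy=x^2$.
   Context: Rings are associative but need not have a unit element unless called unitary. $(R,\wedge)$ is a meet-semilattice if $\wedge$ is idempotent, commutative and associative; its induced order is $x\le y:\Leftrightarrow x\wedge y=x$. *)

(* Defs.v *)
From mathcomp Require Import all_boot all_order all_algebra.

Set Implicit Arguments.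
Unset Strict Implicit.
Unset Printing Implicit Defensive.

Import GRing.Theory.
Local Open Scope ring_scope.

(* MathComp rings are unital, so a not necessarily unitary ring is given by its
   additive group, a zmodType, together with a multiplication mul on it. *)
Definition comm_ring_mul (R : zmodType) (mul : R -> R -> R) : Prop :=
  [/\ associative mul, commutative mul,
      left_distributive mul +%R & right_distributive mul +%R].

(* Without a unit only the powers with k > 0 make sense; for k = 0 the value
   is 0, a junk value. *)
Definition mul_exp (R : zmodType) (mul : R -> R -> R) (x : R) (k : nat) : R :=
  iterop k mul x 0.

Definition ring_meet (R : zmodType) (mul : R -> R -> R) (q : nat) (x y : R) : R :=
  \sum_(1 <= i < q) mul (mul_exp mul x i) (mul_exp mul y (q - i)%N).

(* Order.meetSemilatticeType bundles a meet with a previously given order; here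
   the meet comes first and the order is induced by it. *)
Definition meet_semilattice (T : Type) (meet : T -> T -> T) : Prop :=
  [/\ idempotent_op meet, commutative meet & associative meet].

Definition induced_le (T : Type) (meet : T -> T -> T) (x y : T) : Prop :=
  meet x y = x.

Definition smallest_element (T : Type) (le : T -> T -> Prop) (a : T) : Prop :=
  forall x, le a x.

(* Main.v *)
Require Import Defs.
From mathcomp Require Import all_boot all_order all_algebra.
Local Open Scope ring_scope.

(** Write a <= b for a b = a^2.  Since x^q = x with q >= 2, the ring is reduced,
    and this makes <= a partial order.  Let m be the sum defining x /\ y.
    Telescoping gives x m - y m = x^q y - x y^q = 0.  If x z = y z = t z, then
    each of the q - 1 terms of m z equals t^q z = t z, and q - 1 is odd, so
    m z = t z.  With z = m, t = x this yields m <= x, y; with z = t a lower bound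
    of x and y it yields z <= m.  So /\ computes greatest lower bounds for <=. *)

Import GRing.Theory.

Section Meet.

Variables (R : zmodType) (mul : R -> R -> R).
Hypothesis ring_mul : comm_ring_mul mul.
Hypothesis char2 : forall x : R, x + x = 0.

Local Notation "x ** y" := (mul x y) (at level 40, left associativity).
Local Notation "x ^^ k" := (mul_exp mul x k) (at level 30).

Let mulA : associative mul. Proof. by case: ring_mul. Qed.
Let mulC : commutative mul. Proof. by case: ring_mul. Qed.
Let mulDl : left_distributive mul +%R. Proof. by case: ring_mul. Qed.
Let mulDr : right_distributive mul +%R. Proof. by case: ring_mul. Qed.

Lemma mul_zerol x : 0 ** x = 0.
Proof. by apply: (addrI (0 ** x)); rewrite -mulDl !addr0. Qed.

Lemma mul_suml (I : Type) (r : seq I) (F : I -> R) z :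
  (\sum_(i <- r) F i) ** z = \sum_(i <- r) F i ** z.
Proof.
by apply: (big_morph (mul^~ z)) => [x y|]; rewrite ?mulDl ?mul_zerol.
Qed.

Lemma mul_expS x k : (0 < k)%N -> x ^^ k.+1 = x ** x ^^ k.
Proof. by case: k. Qed.

(** Both exponents must be positive: there is no unit, and exponent 0 gives the default value 0. *)
Lemma mul_expD x i j : (0 < i)%N -> (0 < j)%N ->
  x ^^ (i + j)%N = x ^^ i ** x ^^ j.
Proof.
case: i => // i _ j_gt0; elim: i => [|i IHi]; first by rewrite add1n mul_expS.
by rewrite addSn mul_expS // IHi mulA -mul_expS.
Qed.

(** Induction on [k]: [x (x^k z) = x (y^k z) = y^k (x z) = y^k (y z)]. *)
Lemma mul_exp_congr x y z k : (0 < k)%N -> x ** z = y ** z ->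
  x ^^ k ** z = y ^^ k ** z.
Proof.
case: k => // k _ xyz; elim: k => // k IHk.
rewrite mul_expS // -mulA IHk mulA [x ** _]mulC -mulA xyz mulA [_ ** y]mulC.
by rewrite -mul_expS.
Qed.

Lemma eq_char2 (x y : R) : x + y = 0 -> x = y.
Proof. by move=> xy0; apply: (addIr y); rewrite char2. Qed.

Lemma mulrn_odd (x : R) k : odd k -> x *+ k = x.
Proof.
move=> k_odd; rewrite -(odd_double_half k) k_odd mulrnDr -mul2n mulrnA.
by rewrite [x *+ 2]mulr2n char2 mul0rn addr0.
Qed.

Variable n : nat.
Hypothesis n_gt0 : (0 < n)%N.
Hypothesis exp_q : forall x : R, x ^^ (2 ^ n)%N = x.

Local Notation q := (2 ^ n)%N.
Local Notation meet := (ring_meet mul q).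
Local Notation "a <<= b" := (a ** b = a ** a) (at level 70).

Let q_gt1 : (1 < q)%N. Proof. by rewrite -{1}(expn0 2) ltn_exp2l. Qed.

Lemma sqr_eq0 x : x ** x = 0 -> x = 0.
Proof.
move=> xx0; rewrite -(exp_q x) -(subnK q_gt1) addn2.
(* If [q = 2], then [x^q] is [x ** x] itself; otherwise split off [x ** x] from [x^q]. *)
by case: (q - 2)%N => [|k] //; rewrite mul_expS // mul_expS // mulA xx0 mul_zerol.
Qed.

(** Squaring is additive in characteristic 2, so [(x + y)^2 = 0]. *)
Lemma sqr_inj x y : x ** x = y ** y -> x = y.
Proof.
move=> xxyy; apply: eq_char2; apply: sqr_eq0.
by rewrite mulDl !mulDr [y ** x]mulC -xxyy [x ** y + _]addrC char2.
Qed.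

Lemma mul_le_anti a b : a <<= b -> b <<= a -> a = b.
Proof. by move=> ab ba; apply: sqr_inj; rewrite -ab -ba mulC. Qed.

Lemma mul_le_trans b a c : a <<= b -> b <<= c -> a <<= c.
Proof.
move=> ab bc.
(* [a^2 c = a b c = a b^2 = a^2 b = a^3]; hence [(a c)^2 = a^3 c = a^4 = (a^2)^2], and squares can
   be cancelled. *)
have aac : a ** (a ** c) = a ** (a ** a).
  by rewrite mulA -{1}ab -mulA bc mulA ab -mulA ab.
apply: sqr_inj; rewrite -mulA [c ** _]mulC !mulA -[a ** a ** c]mulA aac.
by rewrite -!mulA aac.
Qed.

Lemma meet_mul x y z t : x ** z = t ** z -> y ** z = t ** z ->
  meet x y ** z = t ** z.
Proof.
move=> xz yz; rewrite mul_suml (@eq_big_nat _ _ _ _ _ _ (fun=> t ** z)).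
  rewrite sumr_const_nat mulrn_odd // oddB ?(ltnW q_gt1) //.
  by rewrite oddX eqn0Ngt n_gt0.
move=> i /andP[i_gt0 i_ltq]; have qi_gt0 : (0 < q - i)%N by rewrite subn_gt0.
rewrite -mulA (mul_exp_congr _ _ _ _ qi_gt0 yz) mulA [_ ** t ^^ _]mulC -mulA.
rewrite (mul_exp_congr _ _ _ _ i_gt0 xz) mulA -mul_expD // subnK ?exp_q //.
exact: ltnW.
Qed.

Lemma mul_meet_eq x y : x ** meet x y = y ** meet x y.
Proof.
apply/eqP; rewrite -subr_eq0 ![_ ** meet x y]mulC !mul_suml -sumrB.
(* With [i] running from 1 to [q], both exponents in [g i] stay positive, and the sum collapses to
   [g q - g 1]. *)
pose g i := x ^^ i ** y ^^ (q.+1 - i)%N.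
rewrite (@eq_big_nat _ _ _ _ _ _ (fun i => g i.+1 - g i)).
  rewrite telescope_sumr ?(ltnW q_gt1) // /g subSnn subn1 /= !exp_q.
  by rewrite subrr.
move=> i /andP[i_gt0 i_ltq]; rewrite /g subSS (subSn (ltnW i_ltq)).
have qi_gt0 : (0 < q - i)%N by rewrite subn_gt0.
by rewrite !mul_expS // -!mulA [_ ** x]mulC [y ^^ _ ** y]mulC mulA [_ ** x]mulC -!mulA.
Qed.

Lemma meet_lel x y : meet x y <<= x.
Proof.
by rewrite mulC; apply/esym/meet_mul; rewrite ?mul_meet_eq.
Qed.

Lemma meet_ler x y : meet x y <<= y.
Proof. by rewrite mulC -mul_meet_eq mulC meet_lel. Qed.

Lemma le_meet x y z : z <<= x -> z <<= y -> z <<= meet x y.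
Proof. by move=> zx zy; rewrite mulC; apply: meet_mul; rewrite mulC. Qed.

(** If [x <<= y], then [x] is itself a lower bound of [x] and [y], so it lies below the meet, and
    antisymmetry applies. *)
Lemma induced_leE x y : induced_le meet x y <-> x <<= y.
Proof.
split=> [<-|xy]; first exact: meet_ler.
by apply: mul_le_anti; [apply: meet_lel | apply: le_meet].
Qed.

Lemma meetC : commutative meet.
Proof.
by move=> x y; apply: mul_le_anti; apply: le_meet; exact: meet_lel || exact: meet_ler.
Qed.

(** Both sides are greatest lower bounds of [x], [y], [z]; transitivity serves the comparisons that
    pass through an inner meet. *)
Lemma meetA : associative meet.
Proof.
move=> x y z; have [le_l le_r] := (meet_lel, meet_ler).
apply: mul_le_anti; do !apply: le_meet => //.
- exact: mul_le_trans (le_r _ _) (le_l _ _).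
- exact: mul_le_trans (le_r _ _) (le_r _ _).
- exact: mul_le_trans (le_l _ _) (le_l _ _).
- exact: mul_le_trans (le_l _ _) (le_r _ _).
Qed.

End Meet.

Theorem theorem3p4 (n : nat) (n_gt0 : (0 < n)%N)
    (R : zmodType) (mul : R -> R -> R) (ring_mul : comm_ring_mul mul)
    (char2 : forall x : R, x + x = 0)
    (exp_q : forall x : R, mul_exp mul x (2 ^ n)%N = x) :
  let meet := ring_meet mul (2 ^ n)%N in
  [/\ meet_semilattice meet,
      smallest_element (induced_le meet) 0
    & forall x y : R, induced_le meet x y <-> mul x y = mul_exp mul x 2%N].
Proof.
have leE := induced_leE _ _ ring_mul char2 _ n_gt0 exp_q.
(* [mul_exp mul x 2] reduces to [mul x x], so [leE] fits by conversion. Through [leE], idempotence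
   becomes [x x = x x]. *)
split=> [||x y]; last exact: leE.
- split; [by move=> x; apply/leE | exact: meetC | exact: meetA].
- by move=> x; apply/leE; rewrite !mul_zerol.
Qed.
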